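(* Let $\langle X, \tau_X, \mathcal{I}_X\rangle$ and $\langle Y, \tau_Y, \mathcal{I}_Y\rangle$ be ideal topological spaces. Let $f:\langle X, \tau_X\rangle \to \langle Y, \tau_Y\rangle$ be a continuous function such that $f^{-1}[I]\in \mathcal{I}_X$ for all $I\in \mathcal{I}_Y$. Then the following three equivalent conditions all hold: a) for every $A \subseteq X$, $f\big[\overline{A}^{\tau_X^*}\big] \subseteq \overline{f[A]}^{\tau_Y^*}$; b) for every $B \subseteq Y$, $\overline{f^{-1}[B]}^{\tau_X^*}\subseteq f^{-1}\big[\overline{B}^{\tau_Y^*}\big]$; c) $f:\langle X, \tau_X^*\rangle \to \langle Y, \tau_Y^*\rangle$ is a continuous function.
   Context: An ideal on a nonempty set $X$ is a family $\mathcal{I}\subseteq P(X)$ with $\emptyset\in\mathcal{I}$, closed under taking subsets and under unions of two members (it is not required to be proper: $X \in \mathcal{I}$ is allowed). An ideal topological space is a triple $\langle X,\tau,\mathcal{I}\rangle$ where $\langle X,\tau\rangle$ is a topological space and $\mathcal{I}$ is an ideal on $X$. No separation axioms are assumed. Write $\tau(x)$ for the family of open neighbourhoods of $x$. The local function is $A\mapsto A^*=\{x\in X: A\cap U\notin\mathcal{I}\text{ for each }U\in\tau(x)\}$. The operator $\mathrm{Cl}^*(A)=A\cup A^*$ is a closure operator on $P(X)$, and it generates the topology $\tau^*=\{U\subseteq X: \mathrm{Cl}^*(X\setminus U)=X\setminus U\}$. The topology $\tau_X^*$ is formed from $\tau_X$ and $\mathcal{I}_X$, and $\tau_Y^*$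 from $\tau_Y$ and $\mathcal{I}_Y$. For a topology $\sigma$, $\overline{A}^{\sigma}$ denotes the closure of $A$ with respect to $\sigma$. $f[A]$ denotes direct image and $f^{-1}[B]$ preimage. *)

(* Defs.v *)
From HB Require Import structures.
From mathcomp Require Import all_boot all_order.
From mathcomp Require Import all_classical topology.

Set Implicit Arguments.
Unset Strict Implicit.
Unset Printing Implicit Defensive.

Local Open Scope classical_set_scope.

(* Not required to be proper: [setT] may be a member. *)
Record ideal (T : Type) := Ideal {
  ideal_mem :> set T -> Prop ;
  ideal0 : ideal_mem set0 ;
  ideal_sub : forall A B : set T, A `<=` B -> ideal_mem B -> ideal_mem A ;
  idealU : forall A B : set T,
    ideal_mem A -> ideal_mem B -> ideal_mem (A `|` B)
}.

Section Star.
Variables (X : topologicalType) (I : ideal X).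
Implicit Types A B U V : set X.

Definition local_fun A : set X :=
  [set x | forall U, open_nbhs x U -> ~ I (A `&` U)].

Definition Cl_star A : set X := A `|` local_fun A.

Definition open_star : set_system X := [set U | Cl_star (~` U) = ~` U].

Lemma local_funS A B : A `<=` B -> local_fun A `<=` local_fun B.
Proof.
move=> AB x Ax U xU IBU; apply: (Ax U xU).
by apply: ideal_sub IBU; exact: setSI.
Qed.

Lemma local_fun0 : local_fun set0 = set0.
Proof.
rewrite -subset0 => x /(_ setT); rewrite set0I; apply; last exact: ideal0.
by split=> //; exact: openT.
Qed.

Lemma local_funU A B : local_fun (A `|` B) `<=` local_fun A `|` local_fun B.
Proof.
move=> x ABx; apply: contrapT => /not_orP[].
move=> /existsNP[U /not_implyP[xU /contrapT IAU]].
move=> /existsNP[V /not_implyP[xV /contrapT IBV]].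
apply: (ABx (U `&` V)); first exact: open_nbhsI.
apply: ideal_sub (idealU IAU IBV) => y [[Ay|By] [Uy Vy]]; [left|right] => //.
Qed.

Lemma open_starP U : open_star U <-> local_fun (~` U) `<=` ~` U.
Proof.
by split=> [E|/setUidl //]; rewrite -[X in _ `<=` X]E; exact: subsetUr.
Qed.

Lemma open_starT : open_star setT.
Proof. by apply/open_starP; rewrite setCT local_fun0. Qed.

Lemma open_starI : setI_closed open_star.
Proof.
move=> U V /open_starP oU /open_starP oV; apply/open_starP; rewrite setCI.
by apply: subset_trans (@local_funU _ _) _; exact: setUSS.
Qed.

Lemma open_star_bigU (J : Type) (F : J -> set X) :
  (forall j, open_star (F j)) -> open_star (\bigcup_j F j).
Proof.
move=> oF; apply/open_starP; rewrite setC_bigcup => x Fx j _.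
have /open_starP := oF j; apply; apply: local_funS Fx.
exact: bigcap_inf.
Qed.

End Star.

(* [X] retopologized by the open sets [open_star I]. *)
Definition star_space (X : topologicalType) (I : ideal X) : Type := X.

HB.instance Definition _ (X : topologicalType) (I : ideal X) :=
  Choice.on (star_space I).

HB.instance Definition _ (X : topologicalType) (I : ideal X) :=
  @isOpenTopological.Build (star_space I) (open_star I)
    (open_starT I) (@open_starI X I) (@open_star_bigU X I).

Definition star_closure (X : topologicalType) (I : ideal X) (A : set X) :
  set X := @closure (star_space I) A.

(* Main.v *)
Require Import Defs.
From mathcomp Require Import all_boot all_order.
From mathcomp Require Import all_classical topology.

Local Open Scope classical_set_scope.

(** The heart of the matter is that the local function commutes with preimages
in one direction: [local_fun IX (f @^-1` B) `<=` f @^-1` local_fun IY B].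
A star-closed set is one that contains its local function, so this inclusion
says at once that preimages of star-closed sets are star-closed, which is the
continuity of [f] between the retopologized spaces.  The two inclusions between
closures then hold as they do for any continuous map: the one for preimages by
pulling neighbourhoods back, the one for images by applying it to
[B := f @` A] and using [A `<=` f @^-1` (f @` A)]. *)

(** An open [U] around [f x] with [B `&` U] in [IY] pulls back to an open set
around [x] by continuity, and the trace [f @^-1` B `&` f @^-1` U] is in [IX]
because it is the preimage of a member of [IY]. *)
Lemma local_fun_preimage (X Y : topologicalType) (IX : ideal X) (IY : ideal Y)
    (f : X -> Y) (cf : continuous f)
    (fI : forall J : set Y, IY J -> IX (f @^-1` J)) (B : set Y) :
  local_fun IX (f @^-1` B) `<=` f @^-1` local_fun IY B.
Proof.
move=> x xB U [oU Ufx] IBU; apply: (xB (f @^-1` U)).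
  by split=> //; apply: open_comp oU => y _; exact: cf.
by rewrite -preimage_setI; exact: fI.
Qed.

Lemma continuous_star (X Y : topologicalType) (IX : ideal X) (IY : ideal Y)
    (f : X -> Y) (cf : continuous f)
    (fI : forall J : set Y, IY J -> IX (f @^-1` J)) :
  continuous (f : star_space IX -> star_space IY).
Proof.
apply/continuousP => U /open_starP oU; apply/open_starP.
rewrite preimage_setC => x xU; apply: oU.
exact: (local_fun_preimage _ _ _ _ _ cf fI _ _ xU).
Qed.

Lemma closure_preimage_continuous (S T : topologicalType) (f : S -> T)
    (cf : continuous f) (B : set T) :
  closure (f @^-1` B) `<=` f @^-1` closure B.
Proof.
by move=> x xB U /cf /xB[y [By Uy]]; exists (f y).
Qed.

Theorem theorem8 (X Y : topologicalType)
    (X0 : [set: X] !=set0) (Y0 : [set: Y] !=set0)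
    (IX : ideal X) (IY : ideal Y) (f : X -> Y)
    (cf : continuous f)
    (fI : forall J : set Y, IY J -> IX (f @^-1` J)) :
  [/\ forall A : set X,
        f @` star_closure IX A `<=` star_closure IY (f @` A),
      forall B : set Y,
        star_closure IX (f @^-1` B) `<=` f @^-1` star_closure IY B
    & continuous (f : star_space IX -> star_space IY)].
Proof.
have cfs := continuous_star _ _ _ _ _ cf fI.
have preS (B : set Y) :
    star_closure IX (f @^-1` B) `<=` f @^-1` star_closure IY B.
  exact: (closure_preimage_continuous _ _ _ cfs).
split=> // A _ [x xA <-]; apply: preS.
by apply: closureS xA; exact: preimage_image.
Qed.
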